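(* Let $m,n$ be integers with $1\leq m\leq n-1$. Let $\pi$ be a prime parking function chosen uniformly at random from the set of all prime parking functions of length $n$, and let $C_m(\pi)$ be the number of $m$-cycles of $\pi$. Then the expected number of $m$-cycles is $$\mathbb{E}_n(C_m(\pi))=(m-1)!\,\binom{n-1}{m}\Big/(n-1)^{m}.$$
   Context: A parking function of length $n$ is a sequence $\pi=(\pi_1,\dots,\pi_n)$ of positive integers such that, if $\lambda_1\le\cdots\le\lambda_n$ is the weakly increasing rearrangement of $\pi_1,\dots,\pi_n$, then $\lambda_i\le i$ for all $1\le i\le n$. A parking function $\pi$ of length $n$ is prime if for all $1\le j\le n-1$ one has $\#\{i: \pi_i\le j\}\ge j+1$. For $m\ge 1$, distinct indices $(i_1,\dots,i_m)$ in $\{1,\dots,n\}$ form an $m$-cycle of $\pi$ if $\pi_{i_1}=i_2,\ \pi_{i_2}=i_3,\dots,\pi_{i_{m-1}}=i_m,\ \pi_{i_m}=i_1$; tuples that differ by a cyclic rotation are regarded as the same $m$-cycle. For $m=1$ an $m$-cycle is a fixed point. $\mathbb{E}_n$ denotes expectation with respect to the uniform measure on the (finite) set of prime parking functions of length $n$. *)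

(* Defs.v *)
From HB Require Import structures.
From mathcomp Require Import all_boot all_order all_algebra.
Set Implicit Arguments.
Unset Strict Implicit.
Unset Printing Implicit Defensive.

Definition parking_function (s : seq nat) : bool :=
  all (fun x => 0 < x) s
  && [forall i : 'I_(size s), nth 0 (sort leq s) i <= i.+1].

Definition prime_parking_function (s : seq nat) : bool :=
  parking_function s
  && [forall j : 'I_(size s), (0 < j) ==> (j.+1 <= count (fun x => x <= j) s)].

(* Positions and values are both 0-based in ['I_n]: the index [i : 'I_n] stands
   for the integer [i.+1], so [word f] is (pi_1, ..., pi_n). Both sides being
   shifted by one, pi_i = j reads [f i = j]. *)
Definition word (n : nat) (f : {ffun 'I_n -> 'I_n}) : seq nat :=
  [seq (val (f i)).+1 | i <- enum 'I_n].

Definition PPF (n : nat) : {set {ffun 'I_n -> 'I_n}} :=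
  [set f | prime_parking_function (word f)].

(* Restricting to values in {1, ..., n} loses no parking function. *)
Lemma parking_function_le s x :
  parking_function s -> x \in s -> 0 < x <= size s.
Proof.
case/andP=> /allP s_gt0 /forallP s_le xs; rewrite s_gt0 //=.
have xs' : x \in sort leq s by rewrite mem_sort.
have lt_i : index x (sort leq s) < size s by rewrite -(size_sort leq) index_mem.
have := s_le (Ordinal lt_i); rewrite /= nth_index // => /leq_trans; exact.
Qed.

Lemma parking_function_word n s :
  size s = n -> parking_function s -> exists f : {ffun 'I_n -> 'I_n}, word f = s.
Proof.
move=> <- ps.
have lt_s (i : 'I_(size s)) : (nth 0 s i).-1 < size s.
  by case/andP: (parking_function_le ps (mem_nth 0 (ltn_ord i))); case: (nth 0 s i).
exists [ffun i => Ordinal (lt_s i)].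
apply: (@eq_from_nth _ 0); first by rewrite size_map size_enum_ord.
rewrite size_map size_enum_ord => i lt_i.
rewrite (nth_map (Ordinal lt_i)) ?size_enum_ord // ffunE /= nth_enum_ord //.
by case/andP: (parking_function_le ps (mem_nth 0 lt_i)); case: (nth 0 s i).
Qed.

Lemma word_inj n : injective (@word n).
Proof.
move=> f g /eq_in_map fg; apply/ffunP=> i; apply/val_inj.
by have [] := fg i (mem_enum 'I_n i).
Qed.

Definition cycle_tuples (m n : nat) (f : {ffun 'I_n -> 'I_n}) :
    {set m.-tuple 'I_n} :=
  [set t : m.-tuple 'I_n | uniq t && fcycle f t].

Definition rotation (m : nat) (T : eqType) (s t : m.-tuple T) : bool :=
  [exists k : 'I_m, t == rot k s :> seq T].

Lemma rotation_equivalence m n (f : {ffun 'I_n -> 'I_n}) :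
  {in cycle_tuples m.+1 f & &, equivalence_rel (@rotation m.+1 'I_n)}.
Proof.
have rotP (s t : m.+1.-tuple 'I_n) :
    reflect (exists k, t = rot k s :> seq _) (rotation s t).
  apply: (iffP existsP) => [[k /eqP ->]|[k t_rot]]; first by exists k.
  case: (ltnP k m.+1) => [lt_k | le_k].
    by exists (Ordinal lt_k); apply/eqP.
  by exists ord0; rewrite rot0 t_rot rot_oversize ?size_tuple.
have rot_sym (s t : m.+1.-tuple 'I_n) : rotation s t -> rotation t s.
  case/rotP=> k t_rot; apply/rotP; exists (size s - k).
  by rewrite t_rot -{1}(rotK k s) /rotr size_rot.
have rot_trans (s t u : m.+1.-tuple 'I_n) :
    rotation s t -> rotation t u -> rotation s u.
  move=> /rotP[k tE] /rotP[l uE]; apply/rotP.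
  have [le_k | /ltnW le_k] := leqP k (size s); last first.
    by exists l; rewrite uE tE (rot_oversize le_k).
  have [le_l | /ltnW le_l] := leqP l (size s); last first.
    by exists k; rewrite uE tE (@rot_oversize _ l) // size_rot.
  by eexists; rewrite uE tE rot_add_mod //.
move=> s t u _ _ _; split; first by apply/rotP; exists 0; rewrite rot0.
by move=> st; apply/idP/idP; apply: rot_trans => //; apply: rot_sym.
Qed.

Definition num_cycles (m n : nat) (f : {ffun 'I_n -> 'I_n}) : nat :=
  #|equivalence_partition (@rotation m 'I_n) (cycle_tuples m f)|.

Local Open Scope ring_scope.

Definition expectation (n : nat) (X : {ffun 'I_n -> 'I_n} -> rat) : rat :=
  (\sum_(f in PPF n) X f) / #|PPF n|%:R.

(* Main.v *)
(* Prime parking functions of length n take values in {1, ..., n-1}; identify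
   these with Z/(n-1). By the cycle lemma every map from [n] to Z/(n-1) has
   exactly one translate that is a prime parking function, so conditioning on a
   translation-invariant event reduces to counting all maps. A prescribed cycle
   is not such an event, but prime parking functions are invariant under
   permutation of the positions: the number of f with f(i_1) = i_2, ...,
   f(i_m) = i_1 equals the number of f taking the values i_2, ..., i_m, i_1 at
   fixed positions. Summed over all (i_1, ..., i_m) this counts the f that are
   injective on m fixed positions, a translation-invariant event. *)
Require Import Defs.
From mathcomp Require Import all_boot all_order all_algebra.
From mathcomp Require Import perm action primitive_action alt zify ring.
Import Order.TTheory GRing.Theory Num.Theory.
Set Implicit Arguments.
Unset Strict Implicit.
Unset Printing Implicit Defensive.

(** * Primality through counts of small values *)

(** The parking bound at index [i] amounts to a count of small entries, which the prime bounds
    supply. Values of [g] lie in [nat] so that both entries in ['I_n] and residues modulo [n - 1]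
    are covered. *)
Lemma prime_parkingP n (g : 'I_n -> nat) : 1 < n ->
  reflect (forall j, 0 < j < n -> j < #|[set i | g i < j]|)
    (prime_parking_function [seq (g i).+1 | i <- enum 'I_n]).
Proof.
move=> n_gt1; set s := map _ _.
have sz_s : size s = n by rewrite size_map size_enum_ord.
have count_s j : count (fun x => x <= j) s = #|[set i | g i < j]|.
  rewrite -sum1_card -sum1_count big_map big_enum_cond.
  by apply: eq_bigl => i; rewrite inE.
have countS i j : i <= j -> #|[set k | g k < i]| <= #|[set k | g k < j]|.
  by move=> le_ij; apply/subset_leq_card/subsetP=> k; rewrite !inE => /leq_trans; apply.
apply: (iffP andP) => [[_ /forallP prime_s] j /andP[j_gt0 lt_jn] | prime_g].
  rewrite -sz_s in lt_jn; have := prime_s (Ordinal lt_jn).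
  by rewrite j_gt0 count_s.
split; last first.
  apply/forallP=> j; apply/implyP=> j_gt0.
  by rewrite count_s prime_g // j_gt0 -[X in _ < X]sz_s /=.
apply/andP; split; first by apply/allP=> _ /mapP[i _ ->].
apply/forallP=> i; apply: (@Order.POrderTheory.nth_count_le _ nat) => //.
  by rewrite sort_sorted //; apply: leq_total.
rewrite count_sort count_s.
have lt_in : i < n by rewrite -[X in _ < X]sz_s.
(* The prime bounds stop at [n.-1]; at the last index [i = n.-1] that bound already yields all [n]
   entries. *)
apply: leq_ltn_trans (_ : i <= minn i.+1 n.-1) _; first by lia.
apply: leq_trans (prime_g (minn i.+1 n.-1) _) _; first by lia.
by apply: countS; lia.
Qed.

(** * The cycle lemma *)

(** Past the last minimum [d], values in the same period are larger because [d] is last, and values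
    in the next one because of the gain of 1. Another such [d'] would give [S d' <= S d] if later
    and [S d' < S d] if earlier, against the choice of [d]. *)
Lemma cycle_lemma (N : nat) (S : nat -> int) : 0 < N ->
    (forall k, S (k + N)%N = S k + 1)%R ->
  exists! d : 'I_N, forall j, 0 < j <= N -> (S d < S (d + j)%N)%R.
Proof.
move=> N_gt0 S_period.
(* [d] is the last minimum of [S] on a period. *)
have [d d_min] : exists d : 'I_N, forall e : 'I_N,
    (S d <= S e)%R && ((d < e) ==> (S d < S e)%R).
  have: forall k, k < N -> exists2 d, d <= k & forall e, e <= k ->
      (S d <= S e)%R && ((d < e) ==> (S d < S e)%R).
    elim=> [_|k IHk lt_k].
      by exists 0 => // e; rewrite leqn0 => /eqP->; rewrite lexx ltnn.
    have [d le_dk d_min] := IHk (ltnW lt_k).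
    have [le_S | lt_S] := leP (S k.+1) (S d).
      exists k.+1 => // e le_e; rewrite [k.+1 < e]ltnNge le_e andbT.
      have [->//|ne_e] := eqVneq e k.+1.
      by have /andP[le_de _] := d_min e ltac:(lia); lia.
    exists d => [|e le_e]; first lia.
    have [->|ne_e] := eqVneq e k.+1; first by rewrite lt_S (ltW lt_S) implybT.
    by apply: d_min; lia.
  case/(_ N.-1 ltac:(lia)) => d le_d d_min.
  have lt_d : d < N by lia.
  by exists (Ordinal lt_d) => e; apply: d_min => /=; have := ltn_ord e; lia.
exists d; split=> [j j_bd | d' d'_min].
  have [lt_dj | le_dj] := ltnP (d + j) N.
    by have /andP[_ /implyP] := d_min (Ordinal lt_dj); apply=> /=; lia.
  have lt_dj : d + j - N < N by have := ltn_ord d; lia.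
  have /andP[/= le_S _] := d_min (Ordinal lt_dj).
  by have := S_period (d + j - N); rewrite subnK //; lia.
have d_minj j : 0 < j -> d + j < N -> (S d < S (d + j)%N)%R.
  move=> j_gt0 lt_j; have /andP[_ /implyP] := d_min (Ordinal lt_j); apply=> /=; lia.
apply: val_inj => /=.
have := ltn_ord d; have := ltn_ord d' => d'N dN.
case: (ltngtP d d') => // lt_d.
  have := d'_min (d + N - d') ltac:(lia).
  have := d_minj (d' - d) ltac:(lia) ltac:(lia).
  by rewrite !subnKC ?S_period; lia.
have := d'_min (d - d') ltac:(lia); have /andP[] := d_min d'.
by rewrite subnKC; lia.
Qed.

(** * Translates modulo [n - 1] *)

Lemma card_lt_sum n (h : 'I_n -> nat) j :
  #|[set i | h i < j]| = \sum_(t < j) #|[set i | h i == t]|.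
Proof.
elim: j => [|j IHj]; first by rewrite big_ord0; apply: eq_card0 => i; rewrite inE.
rewrite big_ord_recr /= -IHj -cardsUI addnC [_ :&: _](_ : _ = set0) ?cards0.
  by apply: eq_card => i; rewrite !inE ltnS leq_eqVlt orbC.
by apply/setP=> i; rewrite !inE; case: eqP => [->|]; rewrite ?ltnn ?andbF.
Qed.

(** With [p.+2] positions and [p.+1] residues, [S] gains 1 per period. Its increment from [d] to
    [d + j] is the number of [i] with [g i - d < j], minus [j], so primality of the translate by
    [-d] is the condition of the cycle lemma. *)
Lemma unique_prime_shift p (g : {ffun 'I_p.+2 -> 'I_p.+1}) :
  exists! c : 'I_p.+1,
    prime_parking_function [seq (val (g i - c)%R).+1 | i <- enum 'I_p.+2].
Proof.
(* [inZp] makes the counts periodic, so that a window starting at [d] may run past [p.+1]. *)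
pose a t := #|[set i | g i == inZp t]|.
pose S k : int := ((\sum_(t < k) a t)%:Z - k%:Z)%R.
have aN t : a (p.+1 + t) = a t.
  by apply: eq_card => i; rewrite !inE -!val_eqE /= modnDl.
have sum_aN : \sum_(t < p.+1) a t = p.+2.
  rewrite -[RHS]card_ord -cardsT.
  transitivity (\sum_(t < p.+1) #|[set i | val (g i) == t]|).
    by apply: eq_bigr => t _; apply: eq_card => i; rewrite !inE -val_eqE /= modn_small.
  by rewrite -card_lt_sum; apply: eq_card => i; rewrite !inE ltn_ord.
have S_period k : S (k + p.+1)%N = (S k + 1)%R.
  rewrite /S addnC big_split_ord /= sum_aN.
  by under eq_bigr => t _ do rewrite aN; lia.
have S_shift (d : 'I_p.+1) j : j <= p.+1 ->
    (S d < S (d + j)%N)%R = (j < #|[set i | val (g i - d)%R < j]|).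
  move=> le_j; rewrite card_lt_sum.
  rewrite (eq_bigr (fun t : 'I_j => a (d + t)));
    first by rewrite /S big_split_ord /=; lia.
  move=> t _; apply: eq_card => i; rewrite !inE.
  have lt_t : t < p.+1 by apply: leq_trans le_j.
  have -> : inZp (d + t) = (inZp t + d)%R :> 'I_p.+1.
    by apply: val_inj; rewrite /= modnDml addnC.
  by rewrite -subr_eq -[RHS]val_eqE /= (modn_small lt_t).
have primeE (d : 'I_p.+1) :
    prime_parking_function [seq (val (g i - d)%R).+1 | i <- enum 'I_p.+2] <->
    forall j, 0 < j <= p.+1 -> (S d < S (d + j)%N)%R.
  split=> [/(prime_parkingP _ (isT : 1 < p.+2)) prime_g j j_bd | S_lt].
    by rewrite S_shift; [apply: prime_g | case/andP: j_bd].
  apply/(prime_parkingP _ (isT : 1 < p.+2)) => j j_bd.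
  by rewrite -S_shift ?S_lt //; case/andP: j_bd.
have [d [d_min d_uniq]] := cycle_lemma (isT : 0 < p.+1) S_period.
by exists d; split=> [|d' /primeE]; [apply/primeE | apply: d_uniq].
Qed.

(** Double count of the pairs [(g, c)] with [Q g] and [g - c] prime: each [g] has one [c], and for
    fixed [c] translation is a bijection preserving [Q]. *)
Lemma card_prime_shift p (Q : pred {ffun 'I_p.+2 -> 'I_p.+1}) :
    (forall (c : 'I_p.+1) (g : {ffun 'I_p.+2 -> 'I_p.+1}),
      Q [ffun i => g i + c]%R = Q g) ->
  p.+1 * #|[set g : {ffun 'I_p.+2 -> 'I_p.+1} | Q g
            & prime_parking_function [seq (val (g i)).+1 | i <- enum 'I_p.+2]]|
  = #|[set g | Q g]|.
Proof.
move=> Q_shift; pose P (g : {ffun 'I_p.+2 -> 'I_p.+1}) c :=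
  prime_parking_function [seq (val (g i - c)%R).+1 | i <- enum 'I_p.+2].
transitivity (\sum_(g | Q g) \sum_(c | P g c) 1); last first.
  rewrite -sum1_card; apply: eq_big => [g|g _]; first by rewrite inE.
  have [d [Pd d_uniq]] := unique_prime_shift g.
  by rewrite (big_pred1 d) // => c; apply/idP/eqP => [/d_uniq->//|->//].
rewrite (exchange_big_dep predT) //=.
rewrite -[X in X * _]card_ord -sum_nat_const.
apply: eq_bigr => c _; rewrite -sum1_card.
rewrite [RHS](reindex (fun g : {ffun 'I_p.+2 -> 'I_p.+1} => [ffun i => g i + c]%R)) /=.
  apply: eq_bigl => g; rewrite inE Q_shift; congr (_ && prime_parking_function _).
  by apply: eq_map => i; rewrite ffunE addrK.
exists (fun g : {ffun 'I_p.+2 -> 'I_p.+1} => [ffun i => g i - c]%R) => g _;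
  by apply/ffunP=> i; rewrite !ffunE ?addrK ?subrK.
Qed.

(** * Maps injective on prescribed positions *)

Lemma card_ffun_uniq (I T : finType) m (t : m.-tuple I) :
  uniq t ->
  #|[set g : {ffun I -> T} | uniq (map g t)]| = #|T| ^_ m * #|T| ^ (#|I| - m).
Proof.
move=> t_uniq.
pose im (g : {ffun I -> T}) : m.-tuple T := map_tuple g t.
have fiber (u : m.-tuple T) : #|[set g | im g == u]| = #|T| ^ (#|I| - m).
  (* A fibre is a product: [F] forces one value at each position in [t] and leaves the others
     free. *)
  pose F i : pred T := [pred x | [forall k, (tnth t k == i) ==> (x == tnth u k)]].
  transitivity #|family F|.
    apply: eq_card => g; rewrite inE; apply/eqP/familyP => [im_g i | gF].
      by apply/forallP=> k; apply/implyP=> /eqP<-; rewrite -im_g tnth_map.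
    apply: eq_from_tnth => k; rewrite tnth_map.
    by have /forallP/(_ k)/implyP/(_ (eqxx _))/eqP := gF (tnth t k).
  rewrite card_family foldrE big_image /= (bigID (mem t)) /=.
  rewrite big1 ?mul1n => [|_ /tnthP[k ->]]; last first.
    rewrite -[RHS](card1 (tnth u k)); apply: eq_card => x; rewrite !inE.
    apply/forallP/eqP => [/(_ k)|-> l]; first by rewrite eqxx => /eqP.
    by apply/implyP=> /eqP/(tuple_uniqP _ t_uniq)->.
  rewrite (eq_bigr (fun=> #|T|)) => [|i /negbTE ti]; last first.
    apply: eq_card => x; apply/forallP=> k; apply/implyP=> /eqP tk.
    by rewrite -tk mem_tnth in ti.
  rewrite prod_nat_const; congr (_ ^ _).
  by rewrite -(cardC (mem t)) (card_uniqP t_uniq) size_tuple addKn; apply: eq_card.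
rewrite -[X in X * _](_ : #|[set u : m.-tuple T | uniq u]| = _); last first.
  by rewrite -card_uniq_tuples; apply: eq_card => u; rewrite !inE (introT allP).
rewrite -sum_nat_const -sum1_card (partition_big im uniq) => [|g]; last by rewrite inE.
apply: eq_big => [u|u u_uniq]; first by rewrite inE.
rewrite -(fiber u) -sum1_card; apply: eq_bigl => g; rewrite !inE.
by case: eqP => [im_g|]; rewrite ?andbF // -[map g t]/(val (im g)) im_g u_uniq.
Qed.

(** The prime bound at [j = p.+1] already accounts for all [p.+2] positions. *)
Lemma PPF_lt p (f : {ffun 'I_p.+2 -> 'I_p.+2}) i : f \in PPF p.+2 -> f i < p.+1.
Proof.
rewrite inE => /(prime_parkingP _ (isT : 1 < p.+2))/(_ p.+1 ltac:(lia)).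
rewrite -[X in X <= _]card_ord -cardsT => le_card.
have /eqP/setP/(_ i) : [set i | f i < p.+1] == setT by rewrite eqEcard subsetT.
by rewrite !inE.
Qed.

Lemma card_PPF_uniq p m (t : m.-tuple 'I_p.+2) : uniq t ->
  p.+1 * #|[set f in PPF p.+2 | uniq (map f t)]| = p.+1 ^_ m * p.+1 ^ (p.+2 - m).
Proof.
move=> t_uniq; have := card_ffun_uniq 'I_p.+1 t_uniq; rewrite !card_ord => <-.
rewrite -card_prime_shift => [|c g]; last first.
  rewrite (eq_map (g := +%R^~ c \o g)) => [|i]; last by rewrite ffunE.
  by rewrite map_comp map_inj_uniq //; apply: addIr.
(* [w] reads residues as values in ['I_p.+2]; by [PPF_lt] its image contains every prime parking
   function. *)
pose w (g : {ffun 'I_p.+2 -> 'I_p.+1}) := [ffun i => widen_ord (leqnSn p.+1) (g i)].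
have w_inj : injective w.
  move=> g h /ffunP gh; apply/ffunP=> i; apply: val_inj.
  by have := congr1 val (gh i); rewrite !ffunE.
have in_w g : (w g \in [set f in PPF p.+2 | uniq (map f t)])
    = (g \in [set g : {ffun 'I_p.+2 -> 'I_p.+1} | uniq (map g t) & prime_parking_function
                [seq (val (g i)).+1 | i <- enum 'I_p.+2]]).
  rewrite !inE andbC (eq_map (g := widen_ord (leqnSn p.+1) \o g)) => [|i].
    rewrite map_comp map_inj_uniq => [|i j /(congr1 val) /=]; last exact: val_inj.
    by congr (_ && prime_parking_function _); apply: eq_map => i; rewrite ffunE.
  by rewrite ffunE.
congr (_ * _); rewrite -(card_imset _ w_inj); apply: eq_card => f.
apply/idP/imsetP => [fA | [g gA ->]]; last by rewrite in_w.
have f_prime : f \in PPF p.+2 by case/setIdP: fA.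
pose g : {ffun 'I_p.+2 -> 'I_p.+1} := [ffun i => Ordinal (PPF_lt i f_prime)].
have fw : f = w g.
  by apply/ffunP=> i; apply: val_inj; rewrite !ffunE.
by exists g; rewrite // -in_w -fw.
Qed.

(** * Permuting positions and counting cycle tuples *)

Lemma PPF_perm n (s : {perm 'I_n}) (f : {ffun 'I_n -> 'I_n}) : 1 < n ->
  ([ffun i => f (s i)] \in PPF n) = (f \in PPF n).
Proof.
move=> n_gt1; rewrite !inE.
have card_s j : #|[set i | [ffun i => f (s i)] i < j]| = #|[set i | f i < j]|.
  rewrite -[RHS](card_preimset _ (@perm_inj _ s)).
  by apply: eq_card => i; rewrite !inE ffunE.
by apply/prime_parkingP/prime_parkingP => // f_prime j j_bd;
  have := f_prime j j_bd; rewrite card_s.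
Qed.

Lemma exists_perm_map n m (t u : m.-tuple 'I_n) : uniq t -> uniq u ->
  exists s : {perm 'I_n}, u = map s t :> seq _.
Proof.
move=> t_uniq u_uniq.
have le_mn : m <= #|'I_n| by rewrite -(size_tuple t) -(card_uniqP t_uniq) max_card.
have trans_m := ntransitive_weak le_mn (Sym_trans 'I_n).
have dtupleT (v : m.-tuple 'I_n) : uniq v -> v \in dtuple_on m [set: 'I_n].
  by rewrite inE => ->; apply/subsetP=> x; rewrite inE.
have [s _ ->] := atransP2 trans_m (dtupleT t t_uniq) (dtupleT u u_uniq).
by exists s.
Qed.

Lemma fcycle_map (T : eqType) (f : T -> T) (s : seq T) :
  fcycle f s = (map f s == rot 1 s).
Proof.
case: s => [|x s] //=; rewrite rot1_cons.
(* Only the starting point is generalized; the closing point of the cycle stays [x]. *)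
by elim: s {1 3}x => [|y s IHs] z /=; rewrite eqseq_cons ?eqxx // IHs.
Qed.

(** Each [t] contributes the [f] sending [t] to [rot 1 t]; composing with a permutation that takes
    [t0] to [t] moves this prescription to the positions [t0]. *)
Lemma sum_card_cycle_tuples n m (t0 : m.-tuple 'I_n) : 1 < n -> uniq t0 ->
  \sum_(f in PPF n) #|cycle_tuples m f|
  = #|[set f in PPF n | uniq (map f t0)]|.
Proof.
move=> n_gt1 t0_uniq.
transitivity (\sum_(t : m.-tuple 'I_n | uniq t)
    #|[set f in PPF n | map f t0 == rot 1 t]|).
  under eq_bigr => f _ do rewrite -sum1_card.
  rewrite (exchange_big_dep (fun t : m.-tuple 'I_n => uniq t)) => [|f t _]; last first.
    by rewrite inE => /andP[].
  apply: eq_bigr => t t_uniq; rewrite sum1_card.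
  have [s ts] := exists_perm_map t0_uniq t_uniq.
  pose comp_s (f : {ffun 'I_n -> 'I_n}) := [ffun i => f (s i)].
  have comp_inj : injective comp_s.
    move=> f g /ffunP fg; apply/ffunP=> i.
    by have := fg (s^-1 i)%g; rewrite !ffunE permKV.
  rewrite -(card_preimset _ comp_inj); apply: eq_card => f.
  transitivity ((f \in PPF n) && (map f t == rot 1 t)); last first.
    rewrite [RHS]inE [RHS]inE PPF_perm // ts -map_comp; congr (_ && (_ == _)).
    by apply: eq_map => i /=; rewrite ffunE.
  by rewrite unfold_in /= [t \in _]inE t_uniq fcycle_map.
(* Rotation permutes the injective tuples, so each possible tuple of distinct values on [t0] occurs
   once as [rot 1 t]. *)
pose rot1 : m.-tuple 'I_n -> m.-tuple 'I_n := fun t => rot_tuple 1 t.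
have rot1_bij : bijective rot1.
  by exists (fun t => rotr_tuple 1 t) => t; apply: val_inj; rewrite /= ?rotK ?rotrK.
rewrite -[RHS]sum1_card.
rewrite (partition_big (fun f : {ffun 'I_n -> 'I_n} => map_tuple f t0)
  (fun u : m.-tuple 'I_n => uniq u)) => [|f]; last by rewrite inE => /andP[].
rewrite [RHS](reindex rot1) /=; last exact: onW_bij.
apply: eq_big => [t|t t_uniq]; first by rewrite rot_uniq.
rewrite -sum1_card; apply: eq_bigl => f; rewrite !inE -val_eqE /=.
by case: eqP => [->|]; rewrite ?andbF // rot_uniq t_uniq !andbT.
Qed.

(** * From cycle tuples to the expectation *)

Lemma card_cycle_tuples m n (f : {ffun 'I_n -> 'I_n}) : 0 < m ->
  #|cycle_tuples m f| = num_cycles m f * m.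
Proof.
case: m => // m _; have eqR := rotation_equivalence (m := m) (f := f).
apply: card_uniform_partition (equivalence_partitionP eqR).
move=> _ /imsetP[t t_cycle ->].
have [t_uniq t_fcycle] := setIdP t_cycle.
pose rot_t (k : 'I_m.+1) := rot_tuple k t.
have rot_inj : injective rot_t.
  (* The head of [rot k t] is the entry of [t] at index [k], so the rotations of an injective tuple
     are distinct. *)
  move=> k l /(congr1 (fun u : m.+1.-tuple 'I_n => head (thead t) u)).
  rewrite /= -!nth0 /rot !nth_cat !nth_drop
    !size_drop !size_tuple !subn_gt0 !ltn_ord !addn0.
  by move/eqP; rewrite nth_uniq ?size_tuple // => /eqP/val_inj.
rewrite -[RHS]card_ord -(card_imset _ rot_inj); apply: eq_card => u.
rewrite inE; apply/andP/imsetP => [[_ /existsP[k /eqP uk]] | [k _ ->]].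
  by exists k => //; apply: val_inj.
split; last by apply/existsP; exists k.
by rewrite inE rot_uniq t_uniq rot_cycle.
Qed.

Local Open Scope ring_scope.

Theorem theorem3p4 (m n : nat) (hm : (1 <= m)%N) (hmn : (m <= n.-1)%N) :
  expectation (fun f : {ffun 'I_n -> 'I_n} => (num_cycles m f)%:R)
  = ((m.-1)`!)%:R * ('C(n.-1, m))%:R / (n.-1)%:R ^+ m.
Proof.
case: n hmn => [|[|p]] /=; [lia | lia | move=> le_mp].
have le_mn : (m <= p.+2)%N by lia.
have [t t_uniq] : exists t : m.-tuple 'I_p.+2, uniq t.
  have sz_t : size (take m (enum 'I_p.+2)) == m by rewrite size_takel ?size_enum_ord.
  by exists (Tuple sz_t); rewrite take_uniq ?enum_uniq.
(* The empty tuple gives the size of [PPF p.+2] itself, up to the factor [p.+1]. *)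
have := card_PPF_uniq (p := p) (t := [tuple]) isT; rewrite ffactn0 subn0 mul1n.
rewrite (eq_card (B := PPF p.+2)) => [card_PPF|f]; last by rewrite !inE andbT.
have := card_PPF_uniq t_uniq; rewrite -sum_card_cycle_tuples //.
under eq_bigr => f _ do rewrite card_cycle_tuples //.
rewrite -big_distrl /= -bin_ffact /expectation -natr_sum => card_cycles.
set K := (\sum_(f in _) _)%N in card_cycles *.
have PPF_neq0 : #|PPF p.+2| != 0%N.
  by apply: contra_eq_neq card_PPF => ->; rewrite muln0 eq_sym expn_eq0.
apply/eqP; rewrite eqr_div ?expf_neq0 ?pnatr_eq0 //.
(* The factors [m] and [p.+1] are those carried by [card_cycles] and [card_PPF]. *)
rewrite -natrX -!natrM eqr_nat -(eqn_pmul2l hm) -(eqn_pmul2l (ltn0Sn p)); apply/eqP.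
transitivity (p.+1 * (K * m) * p.+1 ^ m)%N; first ring.
rewrite card_cycles -!mulnA -expnD subnK // -card_PPF.
have -> : m`! = (m * m.-1`!)%N by case: (m) hm.
ring.
Qed.
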